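(* For every integer $k \geq 4$, there is no diregular $(2,k,+3)$-digraph. That is, there is no finite digraph $G$ in which every vertex has in-degree and out-degree exactly $2$, which has exactly $1+2+2^2+\dots+2^k+3$ vertices, and which is $k$-geodetic.
   Context: A digraph $G$ is $k$-geodetic if for every ordered pair of (not necessarily distinct) vertices $x,y$ there is at most one directed path from $x$ to $y$ of length at most $k$; the trivial path of length $0$ from $x$ to $x$ counts, so in particular a $k$-geodetic digraph has no loops, no parallel arcs and no directed cycles of length at most $k$. For integers $d,k$ let $M(d,k)=1+d+d^2+\dots+d^k$ (the Moore bound). A $(d,k,+\epsilon)$-digraph is a $k$-geodetic digraph with minimum out-degree $d$ and order $M(d,k)+\epsilon$; it is diregular if every vertex has in-degree and out-degree exactly $d$. *)

(* Defs.v *)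
From mathcomp Require Import all_boot.
Set Implicit Arguments. Unset Strict Implicit. Unset Printing Implicit Defensive.

(* A (simple) digraph is given by a finite vertex type V and an arc relation
   e : rel V (no parallel arcs possible; loops are allowed by the type but are
   excluded by k-geodecity).  A directed path of length l from x to y is
   represented by the sequence p of its vertices after x: path e x p,
   last x p = y, size p = l.  The empty sequence is the trivial path. *)

Definition dpath (V : finType) (e : rel V) (x y : V) (p : seq V) : bool :=
  path e x p && (last x p == y).

Definition k_geodetic (V : finType) (e : rel V) (k : nat) : Prop :=
  forall (x y : V) (p q : seq V),
    dpath e x y p -> size p <= k ->
    dpath e x y q -> size q <= k -> p = q.

Definition outdeg (V : finType) (e : rel V) (x : V) : nat := #|[set y | e x y]|.
Definition indeg (V : finType) (e : rel V) (x : V) : nat := #|[set y | e y x]|.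

Definition diregular (V : finType) (e : rel V) (d : nat) : Prop :=
  forall x : V, outdeg e x = d /\ indeg e x = d.

Definition moore (d k : nat) : nat := \sum_(0 <= i < k.+1) d ^ i.

(* Main.v *)
Require Import Defs.
From mathcomp Require Import all_boot.
From mathcomp Require Import zify.
Set Implicit Arguments. Unset Strict Implicit. Unset Printing Implicit Defensive.

(* Let the excess be at most 3 and at most k, where the digraph is (k+1)-geodetic,
   and let O(u) be the set of vertices at distance more than k+1 from u. Suppose
   u -> a, c and v -> c, b with a <> b. The complement of the out-tree of c of depth k
   is {u} + T(a) + O(u) = {v} + T(b) + O(v), so the trees T(a) and T(b) differ in few
   vertices. A vertex at different depths in the two trees has descendants in only
   one of them, and their number doubles with each level, so the trees agree
   almost everywhere. First this forces b in O(u); then, descending along the unique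
   branch on which the trees differ, either v is in O(u), or O(u) lies on a path from
   b to u. The second in-neighbour v' of a excludes the path, so O(u) contains v, b,
   v' and the other out-neighbour a' of v'. As the excess is at most 3, v = a' or
   v' = b, and moving on to the neighbouring pair yields a 2-cycle or two short paths
   with the same ends.

   Hence two vertices with a common out-neighbour have the same out-neighbours, and
   the digraph is a line digraph. For excess 2 this is impossible as the order is
   odd; for excess 3 the root digraph is k-geodetic with excess 2. *)

(* [lia] translates every boolean hypothesis, membership facts included, at a
   prohibitive cost; only numeric hypotheses are kept. *)
Ltac nat_lia :=
  repeat match goal with
  | H : ?P |- _ =>
    lazymatch type of P with
    | Prop =>
      lazymatch P with
      | is_true (leq _ _) => fail
      | is_true (leq _ _ && leq _ _) => fail
      | @eq nat _ _ => fail
      | _ => clear H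
      end
    end
  end; lia.

Lemma card_bigcup_disjoint (T I : finType) (A : {set I}) (F : I -> {set T}) :
    {in A &, forall i j, i != j -> [disjoint F i & F j]} ->
  #|\bigcup_(i in A) F i| = \sum_(i in A) #|F i|.
Proof.
move=> disjF; pose G i := if i \in A then F i else set0.
rewrite big_mkcond -sum1_card (@partition_disjoint_bigcup _ _ _ _ _ G) => [|i j ij].
  rewrite [RHS]big_mkcond; apply: eq_bigr => i _.
  by rewrite sum1_card /G; case: ifP; rewrite ?cards0.
rewrite /G; case: ifP => iA; last by rewrite -setI_eq0 set0I.
by case: ifP => jA; [apply: disjF | rewrite -setI_eq0 setI0].
Qed.

Lemma mooreS d k : moore d k.+1 = (d * moore d k).+1.
Proof.
rewrite /moore big_nat_recl // expn0 add1n big_distrr /=; congr _.+1.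
by apply: eq_bigr => i _; rewrite expnS.
Qed.

Lemma moore2 k : (moore 2 k).+1 = 2 ^ k.+1.
Proof.
elim: k => [|k IH]; first by rewrite /moore big_nat1.
by rewrite mooreS [RHS]expnS -IH; lia.
Qed.

Section Levels.
Variables (V : finType) (e : rel V).
Implicit Types (x y z : V) (s t h : nat).

Definition out_nbrs x : {set V} := [set y | e x y].
Definition in_nbrs x : {set V} := [set y | e y x].
Notation N := out_nbrs.

Fixpoint level s x : {set V} :=
  if s is s'.+1 then \bigcup_(y in N x) level s' y else [set x].

Definition tree h x : {set V} := \bigcup_(s < h.+1) level s x.

Definition descendants h x : {set V} := \bigcup_(s < h) level s.+1 x.

Definition outliers h x : {set V} := ~: tree h x.

(* Heuchenne's condition: it characterizes line digraphs. *)
Definition heuchenne := forall u v x, x \in N u -> x \in N v -> N u = N v.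

Lemma mem_level0 x : x \in level 0 x. Proof. exact: set11. Qed.

Lemma level1 x : level 1 x = N x.
Proof.
apply/setP=> y; apply/bigcupP/idP => [[z xz /set1P->]//|xy].
by exists y; rewrite ?set11.
Qed.

Lemma level_dpathP s x y :
  reflect (exists2 p, dpath e x y p & size p = s) (y \in level s x).
Proof.
elim: s x => [|s IH] x /=.
  apply: (iffP set1P) => [->|[[|z p] // /andP[_ /eqP]] //].
  by exists [::]; rewrite // /dpath /= eqxx.
apply: (iffP bigcupP) => [[z]|[[|z p] //]].
  rewrite inE => xz /IH[p zyp <-]; exists (z :: p) => //.
  by rewrite /dpath /= xz.
rewrite /dpath /= -andbA => /andP[xz zyp] [sp].
by exists z; [rewrite inE | apply/IH; exists p].
Qed.

Lemma levelD s t x : level (s + t) x = \bigcup_(y in level s x) level t y.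
Proof.
elim: s x => [|s IH] x; first by rewrite big_set1.
rewrite addSn /=; apply/setP=> z.
apply/bigcupP/bigcupP => [[w xw]|[y /bigcupP[w xw wy] yz]].
  rewrite IH => /bigcupP[y wy yz]; exists y => //.
  by apply/bigcupP; exists w.
by exists w => //; rewrite IH; apply/bigcupP; exists y.
Qed.

Lemma level_trans s t x y z :
  y \in level s x -> z \in level t y -> z \in level (s + t) x.
Proof. by move=> xy yz; rewrite levelD; apply/bigcupP; exists y. Qed.

Lemma out_level_trans s x y z : y \in N x -> z \in level s y -> z \in level s.+1 x.
Proof. rewrite -level1; exact: (@level_trans 1). Qed.

Lemma level_out_trans s x y z : y \in level s x -> z \in N y -> z \in level s.+1 x.
Proof. by rewrite -level1 -(addn1 s); apply: level_trans. Qed.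

Lemma out_trans x y z : y \in N x -> z \in N y -> z \in level 2 x.
Proof. by rewrite -(level1 y); apply: out_level_trans. Qed.

Lemma treeP h x y : reflect (exists2 s, s <= h & y \in level s x) (y \in tree h x).
Proof.
apply: (iffP bigcupP) => [[s _ xy]|[s sh xy]]; last by exists (Ordinal (sh : s < h.+1)).
by exists s; rewrite // -ltnS.
Qed.

Lemma descendantsP h x y :
  reflect (exists2 s, 0 < s <= h & y \in level s x) (y \in descendants h x).
Proof.
apply: (iffP bigcupP) => [[s _ xy]|[[|s] // sh xy]]; last by exists (Ordinal sh).
by exists s.+1; rewrite //= ltn_ord.
Qed.

Lemma treeE h x : tree h x = x |: descendants h x.
Proof. by rewrite /tree big_ord_recl. Qed.

Lemma root_in_tree h x : x \in tree h x.
Proof. by rewrite treeE setU11. Qed.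

Lemma level_sub_tree s h x : s <= h -> level s x \subset tree h x.
Proof. by move=> sh; apply/subsetP=> y xy; apply/treeP; exists s. Qed.

Lemma descendants_sub_tree h x : descendants h x \subset tree h x.
Proof. by rewrite treeE subsetUr. Qed.

Lemma descendantsS h x : descendants h.+1 x = \bigcup_(y in N x) tree h y.
Proof.
apply/setP=> z; apply/descendantsP/bigcupP => [[[|s] // sh]|[y xy /treeP[s sh yz]]].
  by case/bigcupP=> y xy yz; exists y => //; apply/treeP; exists s.
by exists s.+1 => //; apply: out_level_trans xy yz.
Qed.

Lemma descendants_pair h x a c : N x = [set a; c] ->
  descendants h.+1 x = tree h a :|: tree h c.
Proof. by move=> Nx; rewrite descendantsS Nx bigcup_setU !big_set1. Qed.

Lemma descendants1 x : descendants 1 x = N x.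
Proof. by rewrite /descendants big_ord1 level1. Qed.

Lemma descendants_sub_out h x y :
  y \in N x -> descendants h y \subset descendants h.+1 x.
Proof.
move=> xy; rewrite descendantsS (bigcup_max y) //; exact: descendants_sub_tree.
Qed.

Lemma outlier_level h x z s : z \in outliers h x -> z \in level s x -> h < s.
Proof.
rewrite inE ltnNge => zO xz; apply: contra zO => sh.
exact: (subsetP (level_sub_tree _ sh)).
Qed.

Lemma outlier_notin_tree h x y z :
  z \in outliers h.+1 x -> y \in N x -> z \notin tree h y.
Proof.
move=> zO xy; apply/negP=> /treeP[s sh yz].
by have := outlier_level zO (out_level_trans xy yz); nat_lia.
Qed.

Lemma vertex_cases h u a c z : N u = [set a; c] ->
  [|| z == u, z \in tree h a, z \in tree h c | z \in outliers h.+1 u].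
Proof.
move=> Nu; rewrite [z \in outliers _ _]inE (treeE _ u) (descendants_pair _ Nu) !inE.
by case: (z == u); case: (z \in tree h a); case: (z \in tree h c).
Qed.

End Levels.

Section Geodetic.
Variables (V : finType) (e : rel V) (k : nat).
Hypothesis geo : k_geodetic e k.
Implicit Types (x y z : V) (s t h : nat).

Notation N := (out_nbrs e).
Notation L := (level e).
Notation T := (tree e).

Lemma level_uniq s t x y : y \in L s x -> y \in L t x -> s <= k -> t <= k -> s = t.
Proof.
move=> /level_dpathP[p xp <-] /level_dpathP[q xq <-] sp sq.
by rewrite (geo xp sp xq sq).
Qed.

Lemma level_self s x : x \in L s x -> s <= k -> s = 0.
Proof. by move=> xx sk; apply: (level_uniq xx (mem_level0 e x)). Qed.

Lemma level_midpoint_uniq s t x y y' z : y \in L s x -> y' \in L s x ->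
  z \in L t y -> z \in L t y' -> s + t <= k -> y = y'.
Proof.
move=> /level_dpathP[p /andP[xp /eqP lp] <-] /level_dpathP[p' /andP[xp' /eqP lp'] sp'].
move=> /level_dpathP[q /andP[yq /eqP lq] sq] /level_dpathP[q' /andP[yq' /eqP lq'] sq'].
move=> lek; have: p ++ q = p' ++ q'.
  apply: (geo (x := x) (y := z)); rewrite /dpath ?size_cat ?cat_path ?last_cat.
  - by rewrite xp lp yq lq eqxx.
  - by rewrite sq.
  - by rewrite xp' lp' yq' lq' eqxx.
  - by rewrite sp' sq'.
by move/eqP; rewrite eqseq_cat ?sp' // => /andP[/eqP pp' _]; rewrite -lp -lp' pp'.
Qed.

Lemma out_level_uniq s x y y' z : y \in N x -> y' \in N x ->
  z \in L s y -> z \in L s y' -> s < k -> y = y'.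
Proof. by rewrite -!level1; apply: level_midpoint_uniq. Qed.

Lemma out_irrefl x : 0 < k -> x \notin N x.
Proof. by move=> k_gt0; apply/negP; rewrite -level1 => /level_self/(_ k_gt0). Qed.

Lemma level_disjoint s x y y' : y \in N x -> y' \in N x -> y != y' -> s < k ->
  [disjoint L s y & L s y'].
Proof.
move=> xy xy' yy' sk; rewrite -setI_eq0; apply: contraR yy' => /set0Pn[z].
by rewrite inE => /andP[yz y'z]; apply/eqP; apply: (out_level_uniq xy xy' yz y'z).
Qed.

Lemma tree_disjoint h x y y' : y \in N x -> y' \in N x -> y != y' -> h < k ->
  [disjoint T h y & T h y'].
Proof.
move=> xy xy' yy' hk; rewrite -setI_eq0; apply: contraR yy' => /set0Pn[z].
rewrite inE => /andP[/treeP[s sh yz] /treeP[t th y'z]].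
have [st] : s.+1 = t.+1.
  by apply: (level_uniq (out_level_trans xy yz) (out_level_trans xy' y'z)); nat_lia.
rewrite -st in y'z; apply/eqP; apply: (out_level_uniq xy xy' yz y'z); nat_lia.
Qed.

Lemma level_mismatch h s t x y z : z \in L t x -> z \in L s y ->
  t < s -> s <= h -> h < k ->
  L (h.+1 - s) z \subset L (t + (h.+1 - s)) x :\: T h y.
Proof.
move=> xz yz ts sh hk; apply/subsetP=> w zw.
rewrite inE (level_trans xz zw) andbT; apply/negP=> /treeP[r rh yw].
by have := level_uniq (level_trans yz zw) yw; nat_lia.
Qed.

Variable d : nat.
Hypothesis outdegE : forall x, #|N x| = d.

Lemma card_level s x : s <= k -> #|L s x| = d ^ s.
Proof.
elim: s x => [|s IH] x sk; first by rewrite cards1.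
rewrite /= card_bigcup_disjoint => [|y y' xy xy' yy']; last first.
  exact: level_disjoint xy xy' yy' sk.
rewrite (eq_bigr (fun=> d ^ s)) => [|y _]; last by apply: IH; nat_lia.
by rewrite sum_nat_const outdegE expnS.
Qed.

Lemma card_tree h x : h <= k -> #|T h x| = moore d h.
Proof.
move=> hk; rewrite -sum1_card partition_disjoint_bigcup => [|s t st].
  rewrite /moore big_mkord; apply: eq_bigr => s _; rewrite sum1_card card_level //.
  by apply: leq_trans hk; rewrite -ltnS.
rewrite -setI_eq0; apply: contraR st => /set0Pn[y]; rewrite inE => /andP[xy xy'].
by apply/eqP/val_inj; apply: (level_uniq xy xy'); apply: leq_trans hk; rewrite -ltnS.
Qed.

Lemma card_outliers eps x : #|V| = moore d k + eps -> #|outliers e k x| = eps.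
Proof. by rewrite -(cardsC (T k x)) card_tree // => /addnI. Qed.

Lemma level_sub_small t z (A : {set V}) : 1 < d -> 0 < t <= k ->
  L t z \subset A -> #|A| < d ^ 2 -> t = 1.
Proof.
move=> d_gt1 /andP[t_gt0 tk] /subset_leq_card; rewrite card_level // => tA Ad.
have : d ^ t < d ^ 2 by apply: leq_ltn_trans Ad.
by rewrite ltn_exp2l //; nat_lia.
Qed.

Lemma out_sub_of_mismatch h s a b x (A : {set V}) : 1 < d -> h < k ->
  x \in N a -> x \in L s b -> 1 < s <= h ->
  (forall j, 1 < j <= h -> L j a :\: T h b \subset A) -> #|A| < d ^ 2 -> N x \subset A.
Proof.
move=> d_gt1 hk ax bx sh subA cardA; have [s_gt1 s_le_h] := andP sh.
rewrite -level1 in ax.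
have sub : L (h.+1 - s) x \subset A.
  by apply: subset_trans (level_mismatch ax bx s_gt1 s_le_h hk) (subA _ _); nat_lia.
have t_range : 0 < h.+1 - s <= k by nat_lia.
have t_eq1 := level_sub_small d_gt1 t_range sub cardA.
by rewrite t_eq1 level1 in sub.
Qed.

(* A vertex of level r of x lying deeper than r below y has at least d descendants
   in some later level of x that fall out of the tree of y. *)
Lemma level_sub_level r h x y : 0 < d -> h < k ->
  (forall z, z \in L r x -> exists2 s, r <= s <= h & z \in L s y) ->
  (forall j, r < j <= h -> #|L j x :\: T h y| < d) ->
  L r x \subset L r y.
Proof.
move=> d_gt0 hk xy_levels few; apply/subsetP=> z xz.
have [s rsh yz] := xy_levels z xz.
have [->//|rs] : r = s \/ r < s by nat_lia.
have sh : s <= h by nat_lia.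
have := subset_leq_card (level_mismatch xz yz rs sh hk).
rewrite card_level => [le_d|]; last by nat_lia.
have lt_d : #|L (r + (h.+1 - s)) x :\: T h y| < d by apply: few; nat_lia.
have := leq_ltn_trans le_d lt_d.
have -> : h.+1 - s = (h - s).+1 by nat_lia.
by rewrite expnS ltnNge leq_pmulr // expn_gt0 d_gt0.
Qed.

Lemma out_sub_of_chain a (R : {set V}) : 1 < d -> 1 < k -> R != set0 ->
  (forall x, x \in N a -> (x \in R) || (R \subset N x)) -> N a \subset R.
Proof.
move=> d_gt1 k_gt1 /set0Pn[w wR] chain; apply/subsetP=> x ax.
have /orP[//|/subsetP Rx] := chain x ax.
have [y ay yx] : exists2 y, y \in N a & y != x.
  have : 0 < #|N a :\ x| by have := cardsD1 x (N a); rewrite ax outdegE; nat_lia.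
  by case/card_gt0P=> y; rewrite !inE => /andP[yx ay]; exists y; rewrite ?inE.
have /orP[yR|/subsetP Ry] := chain y ay.
  have ay1 : y \in L 1 a by rewrite level1.
  by have := level_uniq (out_trans ax (Rx _ yR)) ay1; nat_lia.
have wx : w \in L 1 x by rewrite level1 Rx.
have wy : w \in L 1 y by rewrite level1 Ry.
by case/eqP: yx; apply: (out_level_uniq ay ax wy wx).
Qed.

End Geodetic.

Lemma ltn_succ_exp2 k : 1 < k -> k.+1 < 2 ^ k.
Proof. by case: k => // k; rewrite expnS; have := ltn_expl k (ltnSn 1); lia. Qed.

Section SmallExcess.
Variables (V : finType) (e : rel V) (k eps : nat).
Hypothesis geo : k_geodetic e k.+1.
Hypothesis reg : diregular e 2.
Hypothesis orderE : #|V| = moore 2 k.+1 + eps.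
Hypothesis k_gt1 : 1 < k.
Hypothesis eps_le3 : eps <= 3.
Hypothesis eps_le_k : eps <= k.
Implicit Types (u v w x y z a b c p q : V) (h s t : nat) (B : {set V}).

Notation N := (out_nbrs e).
Notation L := (level e).
Notation T := (tree e).
Notation T' := (descendants e).
Notation O := (outliers e k.+1).

Let outdegE x : #|N x| = 2 := (reg x).1.
Let indegE x : #|in_nbrs e x| = 2 := (reg x).2.
Let cardO x : #|O x| = eps := card_outliers geo outdegE x orderE.

Lemma out_pair x a : a \in N x -> exists2 b, N x = [set a; b] & a != b.
Proof.
have /eqP/cards2P[b [c [bc Nx]]] := outdegE x; rewrite Nx !inE.
by case/orP=> /eqP->; [exists c | exists b; rewrite 1?setUC 1?eq_sym].
Qed.

Definition sharing u v a c b := [/\ N u = [set a; c], N v = [set c; b] & a != b].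

Lemma sharing_sym u v a c b : sharing u v a c b -> sharing v u b c a.
Proof. by case=> Nu Nv ab; split; rewrite 1?eq_sym // setUC. Qed.

Lemma sharing_arcs u v a c b : sharing u v a c b ->
  [/\ a \in N u, c \in N u, c \in N v & b \in N v].
Proof. by case=> -> -> _; rewrite !inE !eqxx !orbT. Qed.

Lemma sharing_neq u v a c b : sharing u v a c b -> [/\ a != c, c != b & u != v].
Proof.
case=> Nu Nv ab; have := outdegE u; have := outdegE v; rewrite Nu Nv !cards2.
case: eqP => // _ _; case: eqP => // ac _; split=> //; apply/eqP=> uv.
have: a \in N v by rewrite -uv Nu set21.
by rewrite Nv !inE (negbTE ab) orbF => /eqP.
Qed.

Lemma sharing_tree u v a c b z : sharing u v a c b -> z \in T k a ->
  [|| z == v, z \in T k b | z \in O v].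
Proof.
move=> sh az; have [ua uc _ _] := sharing_arcs sh; have [ac _ _] := sharing_neq sh.
have [_ Nv _] := sh; have := vertex_cases k z Nv.
by rewrite (disjointFr (tree_disjoint geo ua uc ac (ltnSn k)) az).
Qed.

Lemma sharing_level_far u v a c b j : sharing u v a c b -> u \in L j b -> k <= j.
Proof.
move=> sh bu; have [_ uc vc vb] := sharing_arcs sh.
rewrite leqNgt; apply/negP=> jk; rewrite -level1 in vc.
by have := level_uniq geo vc (out_level_trans vb (level_out_trans bu uc)); nat_lia.
Qed.

Lemma sharing_inlier_reach u v a c b : sharing u v a c b -> b \notin O u ->
  exists2 t, 0 < t <= k & b \in L t a.
Proof.
move=> sh; have [_ _ vc vb] := sharing_arcs sh; have [_ cb _] := sharing_neq sh.
have [Nu _ ab] := sh; have := vertex_cases k b Nu.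
rewrite (disjointFl (tree_disjoint geo vc vb cb (ltnSn k)) (root_in_tree _ _ _)).
move=> /or3P[/eqP bu|/treeP[[|t] tk a_b]|/= ->//] _; last by exists t.+1.
  by have := sharing_level_far (j := 0) sh; rewrite bu mem_level0 => /(_ isT); nat_lia.
by move: a_b; rewrite inE eq_sym (negbTE ab).
Qed.

Lemma sharing_inlier_descend u v a c b t : sharing u v a c b -> b \in L t a ->
  0 < t <= k -> L (k.+1 - t) b \subset u |: O u.
Proof.
move=> sh ab tk; apply/subsetP=> w bw; rewrite in_setU1.
have bw' : w \in T k b by apply/treeP; exists (k.+1 - t) => //; nat_lia.
case/or3P: (sharing_tree (sharing_sym sh) bw') => [->//|/treeP[r rk aw]|->].
  by have := level_uniq geo (level_trans ab bw) aw; nat_lia.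
exact: orbT.
Qed.

Lemma sharing_inlier_bottom u v a c b : sharing u v a c b -> b \notin O u ->
  b \in L k a /\ N b \subset O u.
Proof.
move=> sh bO; have [t tk ab] := sharing_inlier_reach sh bO.
have sub := sharing_inlier_descend sh ab tk.
have t_gt1 : 1 < t.
  have := subset_leq_card sub; rewrite (card_level geo outdegE) ?leq_subr //.
  rewrite cardsU1 cardO; have := ltn_succ_exp2 k_gt1; have := leq_b1 (u \notin O u).
  by case: (t) tk => [|[|t']] //; rewrite subn1 /=; nat_lia.
have {}sub : L (k.+1 - t) b \subset O u.
  apply/subsetP=> w bw; have /setU1P[wu|//] := subsetP sub w bw.
  by rewrite wu in bw; have := sharing_level_far sh bw; nat_lia.
have depth_eq1 : k.+1 - t = 1.
  by apply: (level_sub_small geo outdegE _ _ sub); rewrite ?cardO ?ltnS //; nat_lia.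
rewrite depth_eq1 level1 in sub; split=> //.
by have <- : t = k by nat_lia.
Qed.

Lemma sharing_inlier_tail_outlier u v a c b :
  sharing u v a c b -> b \notin O u -> v \in O u.
Proof.
move=> sh bO; have [ab _] := sharing_inlier_bottom sh bO.
have [_ _ vc vb] := sharing_arcs sh; have [_ _ uv] := sharing_neq sh.
have [Nu _ _] := sh.
have := vertex_cases k v Nu; rewrite eq_sym (negbTE uv) /=.
case/or3P=> [/treeP[r rk av]|/treeP[r rk cv]|//].
  have := sharing_level_far (sharing_sym sh) av.
  by have := level_uniq geo (level_out_trans av vb) ab; nat_lia.
by have := level_self geo (out_level_trans vc cv); nat_lia.
Qed.

Lemma sharing_inlier_outliers u v a c b : sharing u v a c b -> b \notin O u ->
  eps = 3 /\ O u = v |: N b.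
Proof.
move=> sh bO; have [_ NbO] := sharing_inlier_bottom sh bO.
have vO := sharing_inlier_tail_outlier sh bO; have [_ _ _ vb] := sharing_arcs sh.
have vNb : v \notin N b.
  by apply/negP=> bv; have := level_self geo (out_trans vb bv); nat_lia.
have sub : v |: N b \subset O u by rewrite subUset sub1set vO.
have := subset_leq_card sub; rewrite cardsU1 vNb outdegE cardO => le_eps.
split; first by nat_lia.
by apply/esym/eqP; rewrite eqEcard sub cardsU1 vNb outdegE cardO.
Qed.

Section Inlier.
Variables (u v a c b : V).
Hypothesis sh : sharing u v a c b.
Hypothesis b_inlier : b \notin O u.

Lemma inlier_tree z : z \in T k a -> (z \in T k b) || (z \in O v).
Proof.
move=> az; have [ua _ _ _] := sharing_arcs sh.
have vO := sharing_inlier_tail_outlier sh b_inlier.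
case/or3P: (sharing_tree sh az) => [/eqP zv|->//|->]; last exact: orbT.
by rewrite zv (negbTE (outlier_notin_tree vO ua)) in az.
Qed.

Lemma inlier_out_depth s x : x \in N a -> x \in L s b -> 1 < s.
Proof.
move=> ax bx; have [ua _ _ _] := sharing_arcs sh.
have [ab NbO] := sharing_inlier_bottom sh b_inlier; rewrite -level1 in ax.
case: s bx => [/set1P xb|[|//]].
  by rewrite -xb in ab; have := level_uniq geo ax ab; nat_lia.
rewrite level1 => /(subsetP NbO) xO.
by have := outlier_level xO (out_level_trans ua ax); nat_lia.
Qed.

Lemma inlier_card_outliers : a \in O v -> #|O v :\ a| = 2.
Proof.
move=> aO; have [eps_eq3 _] := sharing_inlier_outliers sh b_inlier.
by have := cardsD1 a (O v); rewrite aO cardO eps_eq3 => -[].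
Qed.

Lemma inlier_out_chain x : a \in O v -> x \in N a ->
  (x \in O v :\ a) || (O v :\ a \subset N x).
Proof.
move=> aO ax; have cardOa := inlier_card_outliers aO.
have outside j : 0 < j <= k -> L j a :\: T k b \subset O v :\ a.
  move=> jk; apply/subsetP=> w /setDP[aw wT]; rewrite in_setD1.
  have awT : w \in T k a by apply/treeP; exists j => //; nat_lia.
  have := inlier_tree awT; rewrite (negbTE wT) /= => ->; rewrite andbT.
  by apply/eqP=> wa; rewrite wa in aw; have := level_self geo aw; nat_lia.
have one_le_k : 0 < 1 <= k by nat_lia.
have [/treeP[s sk bx]|xT] := boolP (x \in T k b); last first.
  by rewrite (subsetP (outside 1 one_le_k)) // in_setD xT level1.
have Nx : N x \subset O v :\ a.
  apply: (out_sub_of_mismatch geo outdegE (h := k) _ _ ax bx) => // [|j jk|].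
  - by rewrite (inlier_out_depth ax bx) sk.
  - by apply: outside; nat_lia.
  - by rewrite cardOa.
have /eqP<- : N x == O v :\ a by rewrite eqEcard Nx cardOa outdegE.
by rewrite subxx orbT.
Qed.

Lemma inlier_outliers : O v \subset u |: (a |: N a).
Proof.
case: (boolP (a \in O v)) => [aO|aO]; last first.
  have [_ ->] := sharing_inlier_outliers (sharing_sym sh) aO.
  exact: setUS (subsetUr _ _).
have cardOa := inlier_card_outliers aO.
have sub : N a \subset O v :\ a.
  apply: (out_sub_of_chain geo outdegE) => // [||x]; first exact: ltnW.
    by rewrite -card_gt0 cardOa.
  exact: inlier_out_chain.
have /eqP-> : N a == O v :\ a by rewrite eqEcard sub cardOa outdegE.
by rewrite setD1K // subsetUr.
Qed.

Lemma inlier_outlier_level z s : z \in O v -> z \in L s a -> s <= k -> s <= 1.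
Proof.
move=> /(subsetP inlier_outliers)/setU1P[->|/setU1P[->|az]] az' sk.
- have [ua _ _ _] := sharing_arcs sh.
  by have := level_self geo (out_level_trans ua az'); nat_lia.
- by have := level_self geo az'; nat_lia.
- by rewrite -level1 in az; have := level_uniq geo az az'; nat_lia.
Qed.

Lemma inlier_level2 : L 2 a \subset L 2 b.
Proof.
have [ab NbO] := sharing_inlier_bottom sh b_inlier.
have k_gt2 : 2 < k by have [<- _] := sharing_inlier_outliers sh b_inlier.
have [ua _ _ _] := sharing_arcs sh.
have tree_level j z : 1 < j <= k -> z \in L j a -> z \in T k b.
  move=> jk az; have az' : z \in T k a by apply/treeP; exists j => //; nat_lia.
  case/orP: (inlier_tree az') => // zO.
  by have := inlier_outlier_level zO az; nat_lia.
apply: (level_sub_level geo outdegE (h := k)) => // [z az|j jk].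
  have two_le_k : 1 < 2 <= k by [].
  have /treeP[s sk bz] := tree_level 2 z two_le_k az; exists s => //; rewrite sk andbT.
  case: s bz {sk} => [/set1P zb|[|//]].
    by rewrite -zb in ab; have := level_uniq geo az ab; nat_lia.
  rewrite level1 => /(subsetP NbO) zO.
  by have := outlier_level zO (out_level_trans ua az); nat_lia.
have -> : L j a :\: T k b = set0; last by rewrite cards0.
apply/eqP; rewrite setD_eq0; apply/subsetP=> z; apply: tree_level; nat_lia.
Qed.

End Inlier.

(* Otherwise b is a leaf of the tree of a, and the trees of a and b agree on
   level 2, so b lies on a short cycle. *)
Lemma sharing_head_outlier u v a c b : sharing u v a c b -> b \in O u.
Proof.
move=> sh; apply/negPn/negP=> b_inlier.
have [ab _] := sharing_inlier_bottom sh b_inlier.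
have k_split : k = 2 + (k - 2) by rewrite subnKC.
rewrite k_split levelD in ab; have /bigcupP[y a_y yb] := ab.
have b_y := subsetP (inlier_level2 sh b_inlier) y a_y.
by have := level_self geo (level_trans b_y yb); nat_lia.
Qed.

(* One half of an equality {p} + T'(a) + B = {q} + T'(a') + B' of disjoint unions in
   which p and q occur in T'(a') and T'(a) only as leaves. *)
Definition covered h a a' p q B B' :=
  [/\ T' h a \subset q |: (T' h a' :|: B'), p \in T' h a' :|: B',
      [disjoint p |: B & T' h a],
      forall j, q \in L j a -> h <= j & forall j, p \in L j a' -> h <= j].

Definition balanced h a a' p q B B' :=
  covered h a a' p q B B' /\ covered h a' a q p B' B.

Lemma covered_cases h a a' p q B B' z : covered h a a' p q B B' ->
  z \in T' h a -> [|| z == q, z \in T' h a' | z \in B'].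
Proof. by case=> /subsetP sub _ _ _ _ /sub; rewrite !inE. Qed.

Lemma covered_notin h a a' p q B B' z : covered h a a' p q B B' ->
  z \in T' h a -> z != p /\ z \notin B.
Proof.
by case=> _ _ dis _ _ az; have := disjointFl dis az; rewrite !inE => /norP[].
Qed.

Lemma covered_out h a a' p q B B' x : covered h a a' p q B B' ->
  1 < h <= k -> #|B'| <= 2 -> x \in N a -> x \notin N a' ->
  (x \in B') || (N x \subset q |: B').
Proof.
move=> cov hk cardB' ax a'x; have [_ _ _ q_far _] := cov.
have ax_level := ax; rewrite -level1 in ax_level.
have xT : x \in T' h a by apply/descendantsP; exists 1 => //; nat_lia.
case/or3P: (covered_cases cov xT) => [/eqP xq|/descendantsP[s sh a'_x]|->//].
  by rewrite xq in ax_level; have := q_far _ ax_level; nat_lia.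
have s_gt1 : 1 < s by case: s sh a'_x => [|[|s]] // _; rewrite level1 (negbTE a'x).
apply/orP; right; apply: (out_sub_of_mismatch geo outdegE _ _ ax a'_x (h := h)) => //.
- by nat_lia.
- by nat_lia.
- move=> j jh; apply/subsetP=> w /setDP[aw]; rewrite treeE in_setU1 => wT.
  have aw' : w \in T' h a by apply/descendantsP; exists j => //; nat_lia.
  by rewrite in_setU1; case/or3P: (covered_cases cov aw') wT => -> //=; rewrite ?orbT.
- by rewrite cardsU1; have := leq_b1 (q \notin B'); nat_lia.
Qed.

Lemma covered_disjoint_out h a a' p q B B' : covered h a a' p q B B' ->
  1 < h <= k -> #|B'| <= 2 -> #|B'| < h -> [disjoint N a & N a'] -> N a = B'.
Proof.
move=> cov hk cardB' B'h dis; have [_ _ _ q_far _] := cov.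
have chain x : x \in N a -> (x \in B') || (N x \subset q |: B').
  by move=> ax; apply: (covered_out cov hk cardB' ax); rewrite (disjointFr dis).
have B'0 : 0 < #|B'|.
  rewrite card_gt0; apply/eqP=> B'0.
  have /card_gt0P[x ax] : 0 < #|N a| by rewrite outdegE.
  have := chain x ax; rewrite B'0 inE setU0 => /subset_leq_card.
  by rewrite outdegE cards1.
have sub : N a \subset B'.
  apply: (out_sub_of_chain geo outdegE) => // [||x ax]; first exact: ltnW.
    by rewrite -card_gt0.
  have /orP[->//|Nx] := chain x ax; apply/orP; right.
  case: (boolP (q \in N x)) => [xq|xq].
    have /eqP-> : N x == q |: B'; last exact: subsetUr.
    have := q_far _ (out_trans ax xq); have := leq_b1 (q \notin B').
    by rewrite eqEcard Nx outdegE cardsU1; nat_lia.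
  have NxB' : N x \subset B'.
    apply/subsetP=> y xy; have /setU1P[yq|//] := subsetP Nx y xy.
    by rewrite -yq xy in xq.
  by have /eqP-> : N x == B' by rewrite eqEcard NxB' outdegE.
by apply/eqP; rewrite eqEcard sub outdegE.
Qed.

Lemma covered_level2 h a a' p q B B' : covered h a a' p q B B' ->
  2 < h <= k -> N a = B' -> N a' = B -> L 2 a \subset L 2 a'.
Proof.
move=> cov hk Na Na'; have [_ _ _ q_far _] := cov.
have cases j z : 1 < j <= h -> z \in L j a -> (z == q) || (z \in T' h a').
  move=> jh az; have az' : z \in T' h a by apply/descendantsP; exists j => //; nat_lia.
  case/or3P: (covered_cases cov az') => [->//|->|]; first exact: orbT.
  rewrite -Na -level1 => az_level1.
  by have := level_uniq geo az_level1 az; nat_lia.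
apply: (level_sub_level geo outdegE (h := h)) => // [|z az|j jh]; first by nat_lia.
  have two_le_h : 1 < 2 <= h by nat_lia.
  case/orP: (cases 2 z two_le_h az) => [/eqP zq|/descendantsP[s sh a'z]].
    by rewrite zq in az; have := q_far _ az; nat_lia.
  exists s => //; case/andP: sh => s0 ->; rewrite andbT.
  case: s s0 a'z => [|[|//]] // _; rewrite level1 Na'.
  have az' : z \in T' h a by apply/descendantsP; exists 2.
  by have [_ /negbTE->] := covered_notin cov az'.
have : L j a :\: T h a' \subset [set q].
  apply/subsetP=> z /setDP[az]; rewrite treeE in_setU1 => /norP[_ /negbTE zT].
  have j_gt1 : 1 < j <= h by nat_lia.
  by rewrite inE; have := cases j z j_gt1 az; rewrite zT orbF.
by move/subset_leq_card; rewrite cards1.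
Qed.

Lemma balanced_out_meet h a a' p q B B' : balanced h a a' p q B B' ->
  #|B| = #|B'| -> #|B'| <= 2 -> #|B'| < h <= k -> ~~ [disjoint N a & N a'].
Proof.
move=> [cov cov'] BB' cardB' B'hk; apply/negP=> dis.
have [h_le1|h_gt1] := leqP h 1.
  have h_eq1 : h = 1 by nat_lia.
  have B'0 : B' = set0 by apply/eqP; rewrite -cards_eq0; nat_lia.
  have : N a \subset [set q].
    apply/subsetP=> x ax; have := covered_cases (z := x) cov.
    by rewrite h_eq1 !descendants1 ax B'0 (disjointFr dis ax) !inE /= orbF; apply.
  by move/subset_leq_card; rewrite outdegE cards1.
have [hk B'h] : 1 < h <= k /\ #|B'| < h by split; nat_lia.
have Na := covered_disjoint_out cov hk cardB' B'h dis.
have Na' : N a' = B.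
  by apply: (covered_disjoint_out cov') => //; rewrite ?BB' // disjoint_sym.
have h_gt2 : 2 < h <= k by have := outdegE a; rewrite Na; nat_lia.
have sub := covered_level2 cov' h_gt2 Na' Na.
have [_ pT' dis_pB _ p_far] := cov.
have pT : p \notin T' h a by have := disjointFr dis_pB (setU11 p B) => ->.
case/negP: pT; case/setUP: pT' => [/descendantsP[s sh a'p]|pB'].
  have s_split : s = 2 + (h - 2) by have := p_far _ a'p; nat_lia.
  rewrite s_split levelD in a'p; have /bigcupP[y /(subsetP sub) ay yp] := a'p.
  by apply/descendantsP; exists s => //; rewrite s_split; apply: level_trans ay yp.
by apply/descendantsP; exists 1; [nat_lia | rewrite level1 Na].
Qed.

Lemma covered_sharing h a a' b c b' p q B B' : covered h a a' p q B B' ->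
  0 < h <= k.+1 -> sharing a a' b c b' -> (b == q) || (b \in B').
Proof.
move=> cov hk sh; have bO := sharing_head_outlier (sharing_sym sh).
have [ab _ _ _] := sharing_arcs sh; rewrite -level1 in ab.
have bT : b \in T' h a by apply/descendantsP; exists 1 => //; nat_lia.
case/or3P: (covered_cases cov bT) => [->//|/descendantsP[s sh' a'b]|->].
  by have := outlier_level bO a'b; nat_lia.
exact: orbT.
Qed.

Lemma covered_step h a a' b c b' p q B B' : covered h.+1 a a' p q B B' ->
  0 < h <= k -> sharing a a' b c b' -> b' \in B ->
  covered h b b' p q (B :\ b') (B' :\ b).
Proof.
move=> cov hk sh b'B; have [_ pT' dis q_far p_far] := cov.
have [ab ac _ a'b'] := sharing_arcs sh; have [bc _ _] := sharing_neq sh.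
have [Na Na' _] := sh; have subT := subsetP (descendants_sub_out h ab).
have dis_bc : [disjoint T h b & T h c] by apply: (tree_disjoint geo ab ac bc); nat_lia.
have pT : p \notin T' h.+1 a by rewrite (disjointFr dis (setU11 p B)).
split.
- apply/subsetP=> z bz; have az := subT z bz.
  rewrite in_setU1 in_setU in_setD1; case/or3P: (covered_cases cov az) => [->//|a'z|->].
    have [_ zB] := covered_notin cov az.
    have zb' : z != b' by apply: contraNneq zB => ->.
    move: a'z; rewrite (descendants_pair _ Na') in_setU.
    have bTz := subsetP (descendants_sub_tree _ _ _) z bz.
    rewrite (disjointFr dis_bc bTz) treeE in_setU1 (negbTE zb') /= => ->.
    exact: orbT.
  have -> : z != b; last by rewrite !orbT.
  apply/eqP=> zb; move: bz; rewrite zb => /descendantsP[s sh' bb].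
  by have := level_self geo bb; nat_lia.
- rewrite in_setU in_setD1; move: pT; rewrite (descendants_pair _ Na) in_setU.
  case/norP=> pbT pc; have -> /= : p != b.
    by apply: contraNneq pbT => ->; apply: root_in_tree.
  move: pT'; rewrite (descendants_pair _ Na') !in_setU (negbTE pc) treeE in_setU1.
  case: eqP => // pb'; move: a'b'; rewrite -level1 -pb' => /p_far; nat_lia.
- apply: disjointWl (setUS _ (subD1set _ _)) _.
  by apply: disjointWr dis; apply/subsetP.
- by move=> j bq; apply: q_far (out_level_trans ab bq).
- by move=> j b'p; apply: p_far (out_level_trans a'b' b'p).
Qed.

(* Unless q is in B, the trees differ along a single branch that descends from a'
   through all of B to p. *)
Lemma balanced_descent h a a' p q B B' : balanced h a a' p q B B' ->
  #|B| = #|B'| -> #|B'| <= 2 -> #|B'| < h <= k ->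
  q \in B \/ p \in L h a' /\ forall y, y \in B -> exists2 j, j < h & p \in L j y.
Proof.
elim: h a a' B B' => [|h IH] a a' B B' bal BB' cardB' B'hk; first by nat_lia.
have /pred0Pn[c /andP[/= ac a'c]] := balanced_out_meet bal BB' cardB' B'hk.
have [b Na bc] := out_pair ac; have [b' Na' b'c] := out_pair a'c.
have [cov cov'] := bal; have [_ qT dis p_far q_far] := cov'.
have [bb'|bb'] := eqVneq b b'.
  left; move: qT; rewrite !descendantsS Na bb' -Na' -descendantsS in_setU.
  by rewrite (disjointFr dis (setU11 q B')).
have sh : sharing a a' b c b' by split=> //; rewrite setUC.
have [ab _ _ a'b'] := sharing_arcs sh; rewrite -!level1 in ab a'b'.
have hSk : 0 < h.+1 <= k.+1 by nat_lia.
have bq := covered_sharing cov hSk sh.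
have b'p := covered_sharing cov' hSk (sharing_sym sh).
have [h_eq0|h_gt0] := posnP h.
  have B0 : B = set0 by apply/eqP; rewrite -cards_eq0 BB'; nat_lia.
  right; rewrite B0 inE orbF in b'p *; rewrite h_eq0 -(eqP b'p).
  by split=> // y; rewrite inE.
have {bq}bB' : b \in B'.
  by case/orP: bq => // /eqP bq; rewrite bq in ab; have := q_far _ ab; nat_lia.
have {b'p}b'B : b' \in B.
  by case/orP: b'p => // /eqP b'p; rewrite b'p in a'b'; have := p_far _ a'b'; nat_lia.
have hk : 0 < h <= k by nat_lia.
have bal' : balanced h b b' p q (B :\ b') (B' :\ b).
  by split; [exact: covered_step cov hk sh b'B
            |exact: covered_step cov' hk (sharing_sym sh) bB'].
have := cardsD1 b' B; have := cardsD1 b B'; rewrite b'B bB' => cardB'D cardBD.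
have [|||/setD1P[_ ->]|[b'p branch]] := IH _ _ _ _ bal'; [nat_lia..|by left|right].
rewrite level1 in a'b'; split=> [|y yB]; first exact: out_level_trans a'b' b'p.
have [->|yb'] := eqVneq y b'; first by exists h.
have [|j jh yp] := branch y; first by rewrite in_setD1 yb'.
by exists j => //; nat_lia.
Qed.

Lemma sharing_covered u v a c b : sharing u v a c b ->
  covered k a b u v (O u :\ b) (O v :\ a).
Proof.
move=> sh; have [ua uc _ _] := sharing_arcs sh; have [_ _ uv] := sharing_neq sh.
have bO := sharing_head_outlier sh; have [_ Nv _] := sh.
have tree_irrefl y : y \in N u -> u \notin T k y.
  move=> uy; apply/negP=> /treeP[s sk yu].
  by have := level_self geo (out_level_trans uy yu); nat_lia.
have T'T y : {subset T' k y <= T k y} by apply/subsetP/descendants_sub_tree.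
split.
- apply/subsetP=> z az; have azT := T'T a z az.
  have za : z != a.
    apply/eqP=> za; move: az; rewrite za => /descendantsP[s sk aa].
    by have := level_self geo aa; nat_lia.
  have zb : z != b by apply: contraTneq azT => ->; apply: outlier_notin_tree bO ua.
  have := sharing_tree sh azT; rewrite treeE !in_setU1 (negbTE zb) /=.
  by rewrite in_setU in_setD1 za.
- have ub : u != b.
    apply/eqP=> ub; have := outlier_level (s := 0) bO.
    by rewrite ub mem_level0 => /(_ isT).
  have ua' : u != a by apply: contraTneq ua => <-; apply: (out_irrefl geo).
  have := vertex_cases k u Nv; rewrite (negbTE uv) (negbTE (tree_irrefl c uc)) /=.
  by rewrite treeE in_setU1 (negbTE ub) in_setU in_setD1 ua'.
- rewrite disjoint_sym disjoints_subset; apply/subsetP=> z /T'T az.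
  have zO : z \notin O u by apply: contraL az => zO; apply: outlier_notin_tree zO ua.
  rewrite in_setC in_setU1 in_setD1 (negbTE zO) andbF orbF.
  by apply: contraTneq az => ->; apply: tree_irrefl.
- by move=> j; apply: sharing_level_far (sharing_sym sh).
- by move=> j; apply: sharing_level_far sh.
Qed.

Lemma sharing_branch u v a c b : sharing u v a c b ->
  v \in O u \/
  u \in L k b /\ forall y, y \in O u -> y != b -> exists2 j, j < k & u \in L j y.
Proof.
move=> sh; have sh' := sharing_sym sh.
have := cardsD1 b (O u); have := cardsD1 a (O v).
rewrite (sharing_head_outlier sh) (sharing_head_outlier sh') !cardO => cardOv cardOu.
have bal : balanced k a b u v (O u :\ b) (O v :\ a).
  by split; [exact: sharing_covered sh | exact: sharing_covered sh'].
have [|||/setD1P[_ vO]|[bu branch]] := balanced_descent bal; [nat_lia..|by left|right].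
by split=> // y yO yb; apply: branch; rewrite in_setD1 yb.
Qed.

Lemma sharing_extend u v a c b : sharing u v a c b -> exists v' a', sharing v' u a' a c.
Proof.
move=> sh; have [ua uc vc _] := sharing_arcs sh; have [ac _ uv] := sharing_neq sh.
have [Nu Nv ab] := sh.
have [v' v'a v'u] : exists2 v', a \in N v' & v' != u.
  have : 0 < #|in_nbrs e a :\ u|.
    have := cardsD1 u (in_nbrs e a); rewrite indegE.
    by move: ua; rewrite !inE => ->; nat_lia.
  by case/card_gt0P=> v'; rewrite !inE => /andP[v'u v'a]; exists v'; rewrite ?inE.
have [a' Nv' aa'] := out_pair v'a; exists v', a'; split=> //; first by rewrite setUC.
apply/eqP=> a'c; have v'c : c \in N v' by rewrite Nv' a'c set22.
have v'v : v' != v by apply: contraTneq v'a => ->; rewrite Nv !inE negb_or ac ab.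
have : [set v'; u; v] \subset in_nbrs e c.
  by rewrite !subUset !sub1set !inE in uc vc v'c *; rewrite uc vc v'c.
move/subset_leq_card; rewrite indegE -setUA cardsU1 cards2 uv !inE negb_or.
by rewrite v'u v'v.
Qed.

(* Otherwise the tree of b avoids those of a and c, hence is made of outliers of u. *)
Lemma sharing_consecutive_heads v' u v a' a c b :
  sharing v' u a' a c -> sharing u v a c b -> a' != b.
Proof.
move=> sh' sh; apply/eqP=> a'b; rewrite a'b in sh'.
have [v'b v'a _ _] := sharing_arcs sh'; have [ba _ _] := sharing_neq sh'.
have : T k b \subset u |: O u.
  apply/subsetP=> z bz; rewrite in_setU1.
  case/or3P: (sharing_tree (sharing_sym sh) bz) => [->//|az|->]; last exact: orbT.
  by have := disjointFr (tree_disjoint geo v'b v'a ba (ltnSn k)) bz; rewrite az.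
move/subset_leq_card; rewrite (card_tree geo outdegE) // cardsU1 cardO.
have := ltn_succ_exp2 k_gt1; have := moore2 k; have := leq_b1 (u \notin O u).
by rewrite expnS; nat_lia.
Qed.

Lemma sharing_tail_outlier u v a c b : sharing u v a c b -> v \in O u.
Proof.
move=> sh; case: (sharing_branch sh) => // -[bu branch].
have [v' [a' sh']] := sharing_extend sh; have a'b := sharing_consecutive_heads sh' sh.
have [_ v'a ua _] := sharing_arcs sh'; have [_ _ v'u] := sharing_neq sh'.
case: (sharing_branch (sharing_sym sh')) => [v'O|[a'u _]]; last first.
  have [j jk a'_u] := branch a' (sharing_head_outlier (sharing_sym sh')) a'b.
  by have := level_uniq geo a'u a'_u; nat_lia.
have [j jk v'_u] : exists2 j, j <= k & u \in L j v'.
  have [->|v'b] := eqVneq v' b; first by exists k.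
  by have [j jk v'_u] := branch v' v'O v'b; exists j; rewrite // ltnW.
rewrite -level1 in v'a.
have j_eq0 : j = 0 by have := level_uniq geo v'a (level_out_trans v'_u ua); nat_lia.
by move: v'_u; rewrite j_eq0 inE eq_sym (negbTE v'u).
Qed.

(* Otherwise v, b, v' and a' are four distinct outliers of u. *)
Lemma sharing_consecutive_eq v' u v a' a c b :
  sharing v' u a' a c -> sharing u v a c b -> v = a' \/ v' = b.
Proof.
move=> sh' sh; have a'b := sharing_consecutive_heads sh' sh.
have [v'a' v'a _ _] := sharing_arcs sh'; have [_ _ _ vb] := sharing_arcs sh.
have [ac _ _] := sharing_neq sh; have [_ Nv ab] := sh.
have [->|va'] := eqVneq v a'; first by left.
have [->|v'b] := eqVneq v' b; first by right.
have v'v : v' != v by apply: contraTneq v'a => ->; rewrite Nv !inE negb_or ac ab.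
have v_b : v != b by apply: contraTneq vb => ->; apply: (out_irrefl geo).
have v'_a' : v' != a' by apply: contraTneq v'a' => ->; apply: (out_irrefl geo).
have /card_uniqP card4 : uniq [:: v; b; v'; a'].
  rewrite /= !inE !negb_or v_b va' v'_a' [b == a']eq_sym a'b ![_ == v']eq_sym.
  by rewrite v'v v'b.
have /subset_leq_card : [:: v; b; v'; a'] \subset O u.
  apply/subsetP=> y; rewrite mem_seq4 => /or4P[]/eqP->.
  - exact: sharing_tail_outlier sh.
  - exact: sharing_head_outlier sh.
  - exact: sharing_tail_outlier (sharing_sym sh').
  - exact: sharing_head_outlier (sharing_sym sh').
by rewrite card4 cardO /=; nat_lia.
Qed.

Lemma sharing_consecutive_neq v' u v a' a c b :
  sharing v' u a' a c -> sharing u v a c b -> v <> a'.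
Proof.
move=> sh' sh va'; have [v'' [a'' sh'']] := sharing_extend sh'.
have [v''a'' v''a' _ _] := sharing_arcs sh''.
have [_ uc vc _] := sharing_arcs sh; have [_ _ uv] := sharing_neq sh.
rewrite -va' in v''a'; have [ua''|v''c] := sharing_consecutive_eq sh'' sh'.
  rewrite -ua'' in v''a''; rewrite -!level1 in uc vc.
  by case/eqP: uv; apply: (out_level_uniq geo v''a'' v''a' uc vc); nat_lia.
by rewrite -v''c in vc; have := level_self geo (out_trans v''a' vc); nat_lia.
Qed.

Lemma no_sharing u v a c b : ~ sharing u v a c b.
Proof.
move=> sh; have [v' [a' sh']] := sharing_extend sh.
have [va'|v'b] := sharing_consecutive_eq sh' sh.
  exact: sharing_consecutive_neq sh' sh va'.
exact: sharing_consecutive_neq (sharing_sym sh) (sharing_sym sh') v'b.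
Qed.

Lemma small_excess_heuchenne : heuchenne e.
Proof.
move=> u v x ux vx; have [a Nu xa] := out_pair ux; have [b Nv xb] := out_pair vx.
have [ab|ab] := eqVneq a b; first by rewrite Nu Nv ab.
by case: (@no_sharing u v a x b); split; rewrite // setUC.
Qed.

End SmallExcess.

Section LineRoot.
Variables (V : finType) (e : rel V) (d k : nat).
Hypothesis geo : k_geodetic e k.+1.
Hypothesis k_gt0 : 0 < k.
Hypothesis reg : diregular e d.
Hypothesis d_gt0 : 0 < d.
Hypothesis heu : heuchenne e.
Implicit Types (u v w x y : V).

Notation N := (out_nbrs e).

Let outdegE x : #|N x| = d := (reg x).1.
Let indegE x : #|in_nbrs e x| = d := (reg x).2.

Lemma exists_out_nbr u : exists x, x \in N u.
Proof. by apply/card_gt0P; rewrite outdegE. Qed.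

Lemma exists_in_nbr x : exists u, x \in N u.
Proof.
have /card_gt0P[u] : 0 < #|in_nbrs e x| by rewrite indegE.
by rewrite inE; exists u; rewrite inE.
Qed.

Definition out_sets : {set {set V}} := [set N u | u : V].

Lemma mem_out_sets u : N u \in out_sets.
Proof. exact: imset_f. Qed.

Lemma out_sets_partition : partition out_sets [set: V].
Proof.
apply/and3P; split.
- rewrite eqEsubset subsetT; apply/subsetP=> x _.
  have [u ux] := exists_in_nbr x.
  by apply/bigcupP; exists (N u) => //; apply: mem_out_sets.
- apply/trivIsetP=> _ _ /imsetP[u _ ->] /imsetP[v _ ->] uv.
  rewrite -setI_eq0; apply: contraR uv => /set0Pn[x /setIP[ux vx]].
  by rewrite (heu ux vx).
- apply/imsetP=> -[u _ Nu0]; have [x] := exists_out_nbr u.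
  by rewrite -Nu0 inE.
Qed.

Lemma pblock_out_sets u x : x \in N u -> pblock out_sets x = N u.
Proof.
exact: def_pblock (partition_trivIset out_sets_partition) (mem_out_sets u).
Qed.

Lemma card_twins u : #|[set v | N v == N u]| = d.
Proof.
have [x ux] := exists_out_nbr u; rewrite -(indegE x); apply: eq_card => v; rewrite !inE.
by apply/eqP/idP => [vu|vx]; [rewrite -vu inE in ux | apply: heu ux; rewrite inE].
Qed.

Lemma sibling_out_inj u : {in N u &, injective N}.
Proof.
move=> x y ux uy xy; have [z xz] := exists_out_nbr x; have yz := xz; rewrite xy in yz.
by rewrite -!level1 in xz yz; apply: (out_level_uniq geo ux uy xz yz).
Qed.

(* A vertex x of V becomes an arc, from the block containing x to the block N x. *)
Definition line_root : finType := {A : {set V} | A \in out_sets}.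

Definition root_arc : rel line_root := fun A B => [exists x in val A, N x == val B].

Lemma line_rootP (A : line_root) : exists u, val A = N u.
Proof. by have /imsetP[u _ ->] := valP A; exists u. Qed.

Lemma card_line_root : #|V| = #|line_root| * d.
Proof.
rewrite card_sig -cardsT; apply: card_uniform_partition out_sets_partition.
by move=> _ /imsetP[u _ ->]; apply: outdegE.
Qed.

Lemma root_outdeg A : outdeg root_arc A = d.
Proof.
have [u Au] := line_rootP A.
rewrite /outdeg -(card_imset _ val_inj) -(outdegE u).
rewrite -(card_in_imset (@sibling_out_inj u)).
apply: eq_card => C; apply/imsetP/imsetP => [[B]|[x ux ->]].
  by rewrite inE => /exists_inP[x]; rewrite Au => ux /eqP<- ->; exists x.
exists (Sub (N x) (mem_out_sets x)) => //.
by rewrite inE; apply/exists_inP; exists x; rewrite ?Au.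
Qed.

Lemma root_indeg B : indeg root_arc B = d.
Proof.
have [w Bw] := line_rootP B.
rewrite /indeg -(card_imset _ val_inj) -(card_twins w).
rewrite -(card_in_imset (f := pblock out_sets)) => [|x y]; last first.
  rewrite !inE => /eqP Nx /eqP Ny.
  have [u ux] := exists_in_nbr x; have [v vy] := exists_in_nbr y.
  rewrite (pblock_out_sets ux) (pblock_out_sets vy) => uv.
  by apply: (@sibling_out_inj u); rewrite ?Nx // uv.
apply: eq_card => C; apply/imsetP/imsetP => [[A]|[x]].
  have [u Au] := line_rootP A; rewrite inE => /exists_inP[x].
  by rewrite Au Bw => ux Nx ->; exists x; rewrite ?inE ?(pblock_out_sets ux).
rewrite inE => Nx ->; have [u ux] := exists_in_nbr x.
exists (Sub (N u) (mem_out_sets u)); last by rewrite (pblock_out_sets ux).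
by rewrite inE; apply/exists_inP; exists x; rewrite ?Bw.
Qed.

Lemma root_diregular : diregular root_arc d.
Proof. by move=> A; rewrite root_outdeg root_indeg. Qed.

Lemma root_path_lift (s : seq line_root) A u : val A = N u -> path root_arc A s ->
  exists2 s', path e u s' & map N s' = map val s.
Proof.
elim: s A u => [|B s IH] A u Au /=; first by exists [::].
case/andP=> /exists_inP[x Ax /eqP Nx] /(IH _ _ (esym Nx))[s' xs' Es'].
exists (x :: s'); rewrite /= ?Nx ?Es' // xs' andbT.
by rewrite Au inE in Ax.
Qed.

Lemma root_geodetic : k_geodetic root_arc k.
Proof.
move=> A B s t /andP[As /eqP ls] sk /andP[At /eqP lt] tk.
have [u Au] := line_rootP A; have [w Bw] := line_rootP B.
have [y wy] := exists_out_nbr w.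
have lift r : path root_arc A r -> last A r = B -> size r <= k -> exists r',
    [/\ dpath e u y (rcons r' y), size (rcons r' y) <= k.+1 & map N r' = map val r].
  move=> Ar lr rk; have [r' ur' Er'] := root_path_lift Au Ar.
  exists r'; split=> //; last by rewrite size_rcons -(size_map N) Er' size_map.
  have Nl : N (last u r') = N w by rewrite -(last_map N) Er' -Au last_map lr.
  by rewrite -Nl inE in wy; rewrite /dpath last_rcons eqxx andbT rcons_path ur'.
have [s' [us' sk' Es']] := lift s As ls sk; have [t' [ut' tk' Et']] := lift t At lt tk.
have /eqP := geo us' sk' ut' tk'; rewrite eqseq_rcons => /andP[/eqP st _].
by apply: (inj_map val_inj); rewrite -Es' -Et' st.
Qed.

End LineRoot.

Lemma no_diregular_excess2 (V : finType) (e : rel V) k : 1 < k ->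
  diregular e 2 -> k_geodetic e k.+1 -> #|V| <> moore 2 k.+1 + 2.
Proof.
move=> k_gt1 reg geo orderV.
have heu := small_excess_heuchenne geo reg orderV k_gt1 (leqnSn 2) k_gt1.
by have := card_line_root reg (ltn0Sn 1) heu; rewrite orderV mooreS; lia.
Qed.

Lemma no_diregular_excess3 (V : finType) (e : rel V) k : 2 < k ->
  diregular e 2 -> k_geodetic e k.+1 -> #|V| <> moore 2 k.+1 + 3.
Proof.
case: k => // k k_gt1 reg geo orderV.
have heu := small_excess_heuchenne geo reg orderV (ltnW k_gt1) (leqnn 3) k_gt1.
have root_reg : diregular (@root_arc V e) 2 by exact: root_diregular geo _ reg _ heu.
have root_geo : k_geodetic (@root_arc V e) k.+1 by exact: root_geodetic geo reg _.
apply: (no_diregular_excess2 k_gt1 root_reg root_geo).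
by have := card_line_root reg (ltn0Sn 1) heu; rewrite orderV mooreS; lia.
Qed.

Theorem theorem4 (k : nat) : 4 <= k ->
  ~ (exists (V : finType) (e : rel V),
       [/\ diregular e 2, #|V| = moore 2 k + 3 & k_geodetic e k]).
Proof.
case: k => // k k_gt2 [V [e [reg orderV geo]]].
exact: no_diregular_excess3 k_gt2 reg geo orderV.
Qed.
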